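(* Let $p>0$ be a prime, $k$ a field of characteristic $p$, and $G$ an elementary abelian $p$-group of order $q=p^n$ with $n\ge 1$. Let $W$ be a faithful indecomposable $kG$-module of dimension $2$, and for $1\le i\le q$ set $V_i = S^{i-1}(W)^*$. Let $M=\bigoplus_{s=1}^{p^{n-1}}V_{sp}$. Let $i,j$ be positive integers with $i<p$, $j<q$ and $i+j\le q$. Write $j=rp+j'$ with integers $r\ge 0$ and $0\le j'<p$, and assume that $i+j'\ge p$. Then $$V_{p-i}\otimes V_j\cong_M V_i\otimes V_{pr+p-j'},$$ where $\cong_M$ denotes isomorphism in the stable module category relative to $M$.
   Context: All modules are finite-dimensional. $S^d(W)$ denotes the $d$-th symmetric power of $W$ over $k$ (with $S^0(W)=k$ trivial), and $*$ denotes the dual (contragredient) module. Tensor products are over $k$ with diagonal $G$-action. A $kG$-module $P$ is projective relative to a $kG$-module $M$ if every short exact sequence of $kG$-modules $0\to X\to Y\to P\to 0$ splits whenever the tensored sequence $0\to M\otimes X\to M\otimes Y\to M\otimes P\to 0$ splits; equivalently, $P$ is a direct summand of $X\otimes M$ for some $kG$-module $X$. The stable module category relative to $M$ has $kG$-modules as objects and, as morphisms from $X$ to $Y$, the quotient of $\mathrm{Hom}_{kG}(X,Y)$ by the subspace of homomorphisms factoring through a module projective relative to $M$. One has $X\cong_M Y$ if and only if there exist $kG$-modules $P,Q$, each projective relative to $M$, with $X\oplus P\cong Y\oplus Q$. *)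

(* Defs.v *)
From mathcomp Require Import all_boot all_order all_algebra all_fingroup.
From mathcomp Require Import all_solvable all_character.
From mathcomp.multinomials Require Import mpoly.

Set Implicit Arguments.
Unset Strict Implicit.
Unset Printing Implicit Defensive.

Import GRing.Theory.
Local Open Scope ring_scope.

(* A kG-module is a matrix representation, acting on row vectors on the right
   (v . g = v *m rG g), so a linear map X -> Y is a matrix
   f : 'M_(rdegree X, rdegree Y) and f *m g is "f followed by g". *)

Section SymmetricPowerMatrix.

Variable k : fieldType.

Definition sym_basis (n d : nat) : {set 'X_{1..n < d.+1}} :=
  [set m : 'X_{1..n < d.+1} | mdeg m == d].

Definition sym_monom n d (i : 'I_#|sym_basis n d|) : 'X_{1..n} :=
  bmnm (enum_val i).

(* The algebra endomorphism of k[X_0, .., X_(n-1)] extending the linear map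
   X_l |-> \sum_l' A l l' X_l' of the space of linear forms. *)
Definition sym_subst n (A : 'M[k]_n) : n.-tuple {mpoly k[n]} :=
  [tuple \sum_l' A l l' *: 'X_l' | l < n].

(* S^d(k^n) is the degree d part of k[X_0, .., X_(n-1)], the X_l standing for
   the basis of k^n; row m of the matrix is the image of the monomial X^m. *)
Definition sym_mx d n (A : 'M[k]_n) : 'M[k]_#|sym_basis n d| :=
  \matrix_(i, j) ('X_[sym_monom i] \mPo sym_subst A)@_(sym_monom j).

Lemma sym_subst_homog n (A : 'M[k]_n) (m : 'X_{1..n}) :
  'X_[m] \mPo sym_subst A \is (mdeg m).-homog.
Proof.
rewrite comp_mpolyX mdegE.
elim/big_ind2: _ => [|p d q e hp hq|l _]; first exact: dhomog1.
  exact: dhomogM.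
rewrite -[X in X.-homog]mul1n; apply: dhomogMn.
rewrite tnth_mktuple; apply: rpred_sum => l' _.
by apply: dhomogZ; rewrite dhomogX /= mdeg1.
Qed.

Lemma comp_sym_subst n (A B : 'M[k]_n) (p : {mpoly k[n]}) :
  p \mPo sym_subst (A *m B) = (p \mPo sym_subst A) \mPo sym_subst B.
Proof.
elim/mpolyind: p => [|c m p _ _ IHp]; first by rewrite !comp_mpoly0.
rewrite !comp_mpolyD !comp_mpolyZ IHp; congr (_ *: _ + _).
rewrite !comp_mpolyX rmorph_prod; apply: eq_bigr => l _ /=.
rewrite rmorphXn /= !tnth_mktuple; congr (_ ^+ _).
rewrite raddf_sum /=.
under eq_bigr => l' _ do rewrite mxE scaler_suml.
rewrite exchange_big; apply: eq_bigr => l' _.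
rewrite comp_mpolyZ comp_mpolyXU -tnth_nth tnth_mktuple scaler_sumr.
by apply: eq_bigr => l'' _; rewrite scalerA.
Qed.

Lemma comp_sym_subst1 n (p : {mpoly k[n]}) : p \mPo sym_subst 1%:M = p.
Proof.
rewrite -[RHS]comp_mpoly_id; congr (_ \mPo _).
apply: eq_from_tnth => l; rewrite !tnth_mktuple (bigD1 l) //= mxE eqxx scale1r.
by rewrite big1 ?addr0 // => l' ne; rewrite mxE eq_sym (negbTE ne) scale0r.
Qed.

Lemma sym_mx1 d n : sym_mx d (1%:M : 'M_n) = 1%:M.
Proof.
apply/matrixP=> i j; rewrite !mxE comp_sym_subst1 mcoeffX.
by rewrite -bmeqP (inj_eq enum_val_inj).
Qed.

Lemma sym_mxM d n (A B : 'M[k]_n) :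
  sym_mx d (A *m B) = sym_mx d A *m sym_mx d B.
Proof.
apply/matrixP=> i j; rewrite !mxE comp_sym_subst.
set q := 'X_[_] \mPo _.
have hq : q \is d.-homog.
  have := enum_valP i; rewrite inE => /eqP di.
  by have := sym_subst_homog A (sym_monom i); rewrite di.
have szq : (msize q <= d.+1)%N.
  rewrite msizeE; apply/bigmax_leqP_seq => m mq _.
  by rewrite (dhomogP mdeg d q hq m mq).
have -> : q \mPo sym_subst B =
    \sum_(m : 'X_{1..n < d.+1}) q@_m *: ('X_[m] \mPo sym_subst B).
  rewrite [in LHS](mpolywE szq) linear_sum /=.
  by apply: eq_bigr => m _; rewrite comp_mpolyZ.
rewrite linear_sum (bigID (mem (sym_basis n d))) /= [X in _ + X]big1 ?addr0.
  rewrite big_enum_val /=; apply: eq_bigr => l _.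
  by rewrite !mxE mcoeffZ.
move=> m; rewrite inE => ne.
by rewrite (dhomog_nemf_coeff hq) // scale0r mcoeff0.
Qed.

End SymmetricPowerMatrix.

Section Modules.

Variables (k : fieldType) (gT : finGroupType) (G : {group gT}).
Local Notation kGmod := (representation k G).

Section Powers.

Variables (n : nat) (rG : mx_representation k G n).

Fact sym_mx_repr d : mx_repr G (fun g => sym_mx d (rG g)).
Proof.
by split=> [|x y Gx Gy]; rewrite ?repr_mx1 ?sym_mx1 ?repr_mxM ?sym_mxM.
Qed.
Definition sym_repr d := MxRepresentation (sym_mx_repr d).

Fact dual_mx_repr : mx_repr G (fun g => (rG g^-1%g)^T).
Proof.
split=> [|x y Gx Gy]; first by rewrite invg1 repr_mx1 trmx1.
by rewrite invMg repr_mxM ?groupV // trmx_mul.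
Qed.
Definition dual_repr := MxRepresentation dual_mx_repr.

Definition mx_indecomposable : Prop :=
  (0 < n)%N /\
  forall U V : 'M[k]_n, mxmodule rG U -> mxmodule rG V ->
    (U + V == 1%:M)%MS -> mxdirect (U + V) -> U = 0 \/ V = 0.

End Powers.

Definition tensor_grepr (X Y : kGmod) : kGmod :=
  Representation (prod_repr X Y).

Definition grepr_hom (X Y : kGmod) (f : 'M[k]_(rdegree X, rdegree Y)) : Prop :=
  {in G, forall g, X g *m f = f *m Y g}.

Definition short_exact (X Y Z : kGmod) (f : 'M[k]_(rdegree X, rdegree Y))
    (g : 'M[k]_(rdegree Y, rdegree Z)) : Prop :=
  [/\ grepr_hom f, grepr_hom g, row_free f, row_full g & (f == kermx g)%MS].

(* A short exact sequence with epimorphism g : Y -> Z splits. *)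
Definition split_epi (Y Z : kGmod) (g : 'M[k]_(rdegree Y, rdegree Z)) : Prop :=
  exists2 s : 'M[k]_(rdegree Z, rdegree Y), grepr_hom s & s *m g = 1%:M.

Definition tensor_hom (M X Y : kGmod) (f : 'M[k]_(rdegree X, rdegree Y)) :
    'M[k]_(rdegree (tensor_grepr M X), rdegree (tensor_grepr M Y)) :=
  tprod (1%:M : 'M[k]_(rdegree M)) f.

Definition rel_projective (M P : kGmod) : Prop :=
  forall (X Y : kGmod) (f : 'M[k]_(rdegree X, rdegree Y))
         (g : 'M[k]_(rdegree Y, rdegree P)),
    short_exact f g -> split_epi (tensor_hom M g) -> split_epi g.

Definition factors_rel_projective (M X Y : kGmod)
    (h : 'M[k]_(rdegree X, rdegree Y)) : Prop :=
  exists (P : kGmod) (a : 'M[k]_(rdegree X, rdegree P))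
         (b : 'M[k]_(rdegree P, rdegree Y)),
    [/\ rel_projective M P, grepr_hom a, grepr_hom b & h = a *m b].

(* Isomorphism in the stable category relative to M: mutually inverse classes
   of homomorphisms modulo those factoring through relatively M-projectives. *)
Definition stable_iso (M X Y : kGmod) : Prop :=
  exists (f : 'M[k]_(rdegree X, rdegree Y)) (g : 'M[k]_(rdegree Y, rdegree X)),
    [/\ grepr_hom f, grepr_hom g,
        factors_rel_projective M (f *m g - 1%:M : 'M_(rdegree X)) &
        factors_rel_projective M (g *m f - 1%:M : 'M_(rdegree Y))].

(* V_i = S^(i-1)(W)^*, meaningful for i >= 1 only (V_0 is a junk value). *)
Definition Vmod n (W : mx_representation k G n) (i : nat) : kGmod :=
  Representation (dual_repr (sym_repr W i.-1)).

End Modules.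

(* Main.v *)
Require Import Defs.
From mathcomp Require Import all_boot all_order all_algebra all_fingroup.
From mathcomp Require Import all_solvable all_character.
From mathcomp.multinomials Require Import mpoly.
From mathcomp Require Import zify ring.

(** Let S^d be the d-th symmetric power of W.  The group has exponent p, and 1 is
    the only p-th root of unity in characteristic p, so every group element acts
    on W with determinant 1.  Hence the classical operators of invariant theory
    on S^m (x) S^l, seen as bihomogeneous polynomials in two vector variables,
    are homomorphisms:
    the multiplication Omega by the determinant of the two variables, the
    Cayley operator C lowering both degrees by one, and the polarizations
      S^m (x) S^(l+1) -> S^(m+1) (x) S^l -> S^m (x) S^(l+1).
    Capelli's identity says that Omega C and C Omega are scalars minus the
    composite T of the two polarizations.  Iterating it ([clebsch_gordan]),
    C^l : S^(m+l) (x) S^l -> S^m (x) S^0 = S^m and Omega^l are inverse to each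
    other in one order, and in the other order up to a homomorphism that
    factors through S^(m+l+1) (x) S^(l-1), all this up to the scalar
    \prod_(t < l) (m + t + 2) (t + 1).

    Take m + l = s p - 2 and l <= p - 2.  The scalar is then nonzero, and the
    error term factors through a module whose dual V_(sp) (x) V_l is relatively
    M-projective, V_(sp) being a summand of M.  Dualizing gives
    ([trace_iso_reflect])
      V_(sp-1) (x) V_b  ~  V_(sp-b)   stably, for 0 < b < p.
    Four uses of this isomorphism, with s = 1 and s = r + 1, give the theorem:
      V_(p-i) (x) V_j ~ (V_i (x) V_(p-1)) (x) (V_(p-j') (x) V_(rp+p-1))
                      ~ V_i (x) V_j' (x) V_(rp+p-1) ~ V_i (x) V_(pr+p-j').

    This needs the stable category to be a tensor category.  To that end the
    ideal of maps factoring through relatively M-projective modules is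
    replaced by the ideal of partial traces over M of homomorphisms
    M (x) X -> M (x) Y ([trace_ideal]), which is visibly stable under sums,
    composition and tensor products; [factors_trace] says that partial traces
    do factor through relatively M-projective modules. *)

Set Implicit Arguments.
Unset Strict Implicit.
Unset Printing Implicit Defensive.

Import GRing.Theory.
Local Open Scope ring_scope.

(** * Coordinates on tensor products *)

Section TensorIndex.

Fact tidx_subproof m n (i : 'I_m) (j : 'I_n) : (i * n + j < m * n)%N.
Proof.
by rewrite (@leq_trans (i.+1 * n)) ?leq_mul2r ?ltn_ord ?orbT // mulSnr ltn_add2l.
Qed.

(** The position of e_i (x) e_j in the basis used by [tprod]. *)
Definition tidx m n (i : 'I_m) (j : 'I_n) := Ordinal (tidx_subproof i j).

Fact tfst_subproof m n (u : 'I_(m * n)) : (u %/ n < m)%N.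
Proof. by case: n u => [|n] u; [case: u; rewrite muln0 | rewrite ltn_divLR]. Qed.
Definition tfst m n (u : 'I_(m * n)) := Ordinal (tfst_subproof u).

Fact tsnd_subproof m n (u : 'I_(m * n)) : (u %% n < n)%N.
Proof. by case: n u => [|n] u; [case: u; rewrite muln0 | rewrite ltn_mod]. Qed.
Definition tsnd m n (u : 'I_(m * n)) := Ordinal (tsnd_subproof u).

Lemma tidxK m n (u : 'I_(m * n)) : tidx (tfst u) (tsnd u) = u.
Proof. by apply: val_inj; rewrite /= -divn_eq. Qed.

Lemma tfstK m n (i : 'I_m) (j : 'I_n) : tfst (tidx i j) = i.
Proof.
have n0 : (0 < n)%N by case: n j => // -[].
by apply: val_inj; rewrite /= divnMDl // divn_small ?addn0.
Qed.

Lemma tsndK m n (i : 'I_m) (j : 'I_n) : tsnd (tidx i j) = j.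
Proof. by apply: val_inj; rewrite /= modnMDl modn_small. Qed.

Lemma tidx_ind m n (P : 'I_(m * n) -> Prop) :
  (forall i j, P (tidx i j)) -> forall u, P u.
Proof. by move=> h u; rewrite -(tidxK u). Qed.

Lemma eq_tidx m n (i i' : 'I_m) (j j' : 'I_n) :
  (tidx i j == tidx i' j') = (i == i') && (j == j').
Proof.
apply/eqP/andP=> [e | [/eqP-> /eqP->]] //.
by rewrite -(tfstK i j) -{2}(tsndK i j) e tfstK tsndK.
Qed.

Lemma big_tidx (V : nmodType) m n (F : 'I_(m * n) -> V) :
  \sum_u F u = \sum_i \sum_j F (tidx i j).
Proof.
rewrite pair_big /= (reindex (fun p : 'I_m * 'I_n => tidx p.1 p.2)) //=.
exists (fun u => (tfst u, tsnd u)) => [[i j] _ | u _] /=.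
  by rewrite tfstK tsndK.
exact: tidxK.
Qed.

Definition tassoc a b c (u : 'I_(a * (b * c))) : 'I_(a * b * c) :=
  tidx (tidx (tfst u) (tfst (tsnd u))) (tsnd (tsnd u)).
Definition tassoc_inv a b c (u : 'I_(a * b * c)) : 'I_(a * (b * c)) :=
  tidx (tfst (tfst u)) (tidx (tsnd (tfst u)) (tsnd u)).

Lemma tassocE a b c (x : 'I_a) (y : 'I_b) (z : 'I_c) :
  tassoc (tidx x (tidx y z)) = tidx (tidx x y) z.
Proof. by rewrite /tassoc !(tfstK, tsndK). Qed.

Lemma tassocK a b c : cancel (@tassoc a b c) (@tassoc_inv a b c).
Proof.
apply: tidx_ind => x; apply: tidx_ind => y z.
by rewrite tassocE /tassoc_inv !(tfstK, tsndK).
Qed.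

Lemma tassoc_invK a b c : cancel (@tassoc_inv a b c) (@tassoc a b c).
Proof.
apply: tidx_ind; apply: tidx_ind => x y z.
by rewrite /tassoc_inv tassocE !(tfstK, tsndK).
Qed.

End TensorIndex.

Section Tensor.

Variable k : fieldType.

Lemma tensor_ext m n p q (A B : 'M[k]_(m * n, p * q)) :
  (forall i j i' j', A (tidx i j) (tidx i' j') = B (tidx i j) (tidx i' j')) ->
  A = B.
Proof.
by move=> h; apply/matrixP; apply: tidx_ind => i j; apply: tidx_ind => i' j'.
Qed.

Lemma tidx_ord0 m n (j : 'I_n) :
  tidx (ord0 : 'I_m.+1) j = lshift (m * n) j :> 'I_(n + m * n).
Proof. exact: val_inj. Qed.

Lemma tidx_lift0 m n (i : 'I_m) (j : 'I_n) :
  tidx (lift ord0 i) j = rshift n (tidx i j) :> 'I_(n + m * n).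
Proof. by apply: val_inj; rewrite /= /bump add1n mulSn addnA. Qed.

Lemma trow_tidx n1 m2 n2 (A : 'rV[k]_n1) (B : 'M[k]_(m2, n2)) i j j' :
  trow A B i (tidx j j') = A 0 j * B i j'.
Proof.
elim: n1 A j => [|n1 IH] A j; first by case: j.
case: (unliftP ord0 j) => [j1|] ->.
  rewrite (tidx_lift0 j1 j') /= row_mxEr IH !mxE; congr (A _ _ * _).
  exact: val_inj.
rewrite (tidx_ord0 n1 j') /= row_mxEl !mxE; congr (A _ _ * _).
exact: val_inj.
Qed.

Lemma tprod_tidx m1 n1 (A : 'M[k]_(m1, n1)) m2 n2 (B : 'M[k]_(m2, n2)) i i' j j' :
  tprod A B (tidx i i') (tidx j j') = A i j * B i' j'.
Proof.
elim: m1 n1 A i j => [|m1 IH] n1 A i j; first by case: i.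
case: (unliftP ord0 i) => [i1|] ->.
  rewrite (tidx_lift0 i1 i') /= col_mxEd IH !mxE; congr (A _ _ * _).
  exact: val_inj.
rewrite (tidx_ord0 m1 i') /= col_mxEu trow_tidx !mxE; congr (A _ _ * _).
exact: val_inj.
Qed.

Lemma trmx_tprod m1 n1 (A : 'M[k]_(m1, n1)) m2 n2 (B : 'M[k]_(m2, n2)) :
  (tprod A B)^T = tprod A^T B^T.
Proof. by apply: tensor_ext => i j i' j'; rewrite mxE !tprod_tidx !mxE. Qed.

Lemma tprodDl m1 n1 (A A' : 'M[k]_(m1, n1)) m2 n2 (B : 'M[k]_(m2, n2)) :
  tprod (A + A') B = tprod A B + tprod A' B.
Proof. by apply: tensor_ext => i j i' j'; rewrite !(tprod_tidx, mxE) mulrDl. Qed.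

Lemma tprodZl m1 n1 c (A : 'M[k]_(m1, n1)) m2 n2 (B : 'M[k]_(m2, n2)) :
  tprod (c *: A) B = c *: tprod A B.
Proof. by apply: tensor_ext => i j i' j'; rewrite !(tprod_tidx, mxE) mulrA. Qed.

Lemma tprodZr m1 n1 c (A : 'M[k]_(m1, n1)) m2 n2 (B : 'M[k]_(m2, n2)) :
  tprod A (c *: B) = c *: tprod A B.
Proof.
by apply: tensor_ext => i j i' j'; rewrite !(tprod_tidx, mxE) mulrCA.
Qed.

(** The partial trace M (x) X -> M (x) Y  |->  X -> Y over the factor M. *)
Definition ptrace m a b (t : 'M[k]_(m * a, m * b)) : 'M[k]_(a, b) :=
  \matrix_(x, y) \sum_i t (tidx i x) (tidx i y).

Lemma ptraceD m a b (s t : 'M[k]_(m * a, m * b)) :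
  ptrace (s + t) = ptrace s + ptrace t.
Proof.
by apply/matrixP=> x y; rewrite !mxE -big_split; apply: eq_bigr => i _; rewrite mxE.
Qed.

Lemma ptraceMl m a b c (f : 'M[k]_(c, a)) (t : 'M[k]_(m * a, m * b)) :
  ptrace (tprod (1%:M : 'M_m) f *m t) = f *m ptrace t.
Proof.
apply/matrixP=> x y; rewrite !mxE.
under [RHS]eq_bigr => z _ do rewrite mxE big_distrr /=.
rewrite [RHS]exchange_big; apply: eq_bigr => i _.
rewrite mxE big_tidx (bigD1 i) //= [X in _ + X]big1 ?addr0 => [|j ne].
  by apply: eq_bigr => z _; rewrite tprod_tidx !mxE eqxx mul1r.
by apply: big1 => z _; rewrite tprod_tidx mxE eq_sym (negbTE ne) !mul0r.
Qed.

Lemma ptraceMr m a b c (f : 'M[k]_(b, c)) (t : 'M[k]_(m * a, m * b)) :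
  ptrace (t *m tprod (1%:M : 'M_m) f) = ptrace t *m f.
Proof.
apply/matrixP=> x y; rewrite !mxE.
under [RHS]eq_bigr => z _ do rewrite mxE big_distrl /=.
rewrite [RHS]exchange_big; apply: eq_bigr => i _.
rewrite mxE big_tidx (bigD1 i) //= [X in _ + X]big1 ?addr0 => [|j ne].
  by apply: eq_bigr => z _; rewrite tprod_tidx !mxE eqxx mul1r.
by apply: big1 => z _; rewrite tprod_tidx mxE (negbTE ne) mul0r mulr0.
Qed.

Lemma ptrace_cyclic m n a b (f : 'M[k]_(m, n)) (t : 'M[k]_(n * a, m * b)) :
  ptrace (tprod f (1%:M : 'M_a) *m t) = ptrace (t *m tprod f (1%:M : 'M_b)).
Proof.
have step (x : 'I_a) (y : 'I_b) i :
    (tprod f 1%:M *m t) (tidx i x) (tidx i y)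
    = \sum_j f i j * t (tidx j x) (tidx i y).
  rewrite mxE big_tidx; apply: eq_bigr => j _.
  rewrite (bigD1 x) //= big1 ?addr0 => [|z ne].
    by rewrite tprod_tidx mxE eqxx mulr1.
  by rewrite tprod_tidx mxE eq_sym (negbTE ne) mulr0 mul0r.
have step' (x : 'I_a) (y : 'I_b) j :
    (t *m tprod f 1%:M) (tidx j x) (tidx j y)
    = \sum_i t (tidx j x) (tidx i y) * f i j.
  rewrite mxE big_tidx; apply: eq_bigr => i _.
  rewrite (bigD1 y) //= big1 ?addr0 => [|z ne].
    by rewrite tprod_tidx mxE eqxx mulr1.
  by rewrite tprod_tidx mxE (negbTE ne) mulr0 mulr0.
apply/matrixP=> x y; rewrite !mxE.
rewrite (eq_bigr _ (fun i _ => step x y i)) (eq_bigr _ (fun j _ => step' x y j)).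
rewrite exchange_big; apply: eq_bigr => j _.
by apply: eq_bigr => i _; rewrite mulrC.
Qed.

Definition fun_mx a b (f : 'I_a -> 'I_b) : 'M[k]_(a, b) :=
  \matrix_(u, v) (f u == v)%:R.

Lemma fun_mxE a b c (f : 'I_a -> 'I_b) (A : 'M_(b, c)) u v :
  (fun_mx f *m A) u v = A (f u) v.
Proof.
rewrite mxE (bigD1 (f u)) //= mxE eqxx mul1r big1 ?addr0 // => w ne.
by rewrite mxE eq_sym (negbTE ne) mul0r.
Qed.

Lemma mul_fun_mx a b c (f : 'I_a -> 'I_b) (A : 'M_(c, a)) u v :
  injective f -> (A *m fun_mx f) u (f v) = A u v.
Proof.
move=> injf; rewrite mxE (bigD1 v) //= mxE eqxx mulr1 big1 ?addr0 // => w ne.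
by rewrite mxE (inj_eq injf) (negbTE ne) mulr0.
Qed.

Lemma fun_mxK a b (f : 'I_a -> 'I_b) f' :
  cancel f f' -> fun_mx f *m fun_mx f' = 1%:M.
Proof. by move=> fK; apply/matrixP=> u v; rewrite fun_mxE !mxE fK. Qed.

End Tensor.

(** * The stable category relative to a module *)

Section StableCategory.

Variables (k : fieldType) (gT : finGroupType) (G : {group gT}).
Local Notation kGmod := (representation k G).
Implicit Types X Y Z M V : kGmod.

Lemma hom1 X : @grepr_hom k gT G X X 1%:M.
Proof. by move=> g _; rewrite mulmx1 mul1mx. Qed.

Lemma hom0 X Y : @grepr_hom k gT G X Y 0.
Proof. by move=> g _; rewrite mulmx0 mul0mx. Qed.

Lemma homD X Y (f h : 'M_(rdegree X, rdegree Y)) :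
  grepr_hom f -> grepr_hom h -> grepr_hom (f + h).
Proof. by move=> hf hh g Gg; rewrite mulmxDr mulmxDl hf ?hh. Qed.

Lemma homZ X Y c (f : 'M_(rdegree X, rdegree Y)) :
  grepr_hom f -> grepr_hom (c *: f).
Proof. by move=> hf g Gg; rewrite -scalemxAr -scalemxAl hf. Qed.

Lemma homM X Y Z (f : 'M_(rdegree X, rdegree Y)) (h : 'M_(rdegree Y, rdegree Z)) :
  grepr_hom f -> grepr_hom h -> grepr_hom (f *m h).
Proof. by move=> hf hh g Gg; rewrite mulmxA hf // -!mulmxA hh. Qed.

Lemma hom_tprod X X' Y Y'
    (f : 'M_(rdegree X, rdegree Y)) (h : 'M_(rdegree X', rdegree Y')) :
  grepr_hom f -> grepr_hom h ->
  @grepr_hom k gT G (tensor_grepr X X') (tensor_grepr Y Y') (tprod f h).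
Proof. by move=> hf hh g Gg /=; rewrite -!tprodE hf ?hh. Qed.

Lemma hom_fun_mx X Y (phi : 'I_(rdegree X) -> 'I_(rdegree Y)) :
  bijective phi ->
  {in G, forall g u v, X g u v = Y g (phi u) (phi v)} ->
  grepr_hom (fun_mx k phi).
Proof.
case=> psi phiK psiK e g Gg; apply/matrixP=> u w.
by rewrite -(psiK w) mul_fun_mx ?fun_mxE ?e //; apply: can_inj phiK.
Qed.

Definition summand (V M : kGmod) : Prop :=
  exists (i : 'M[k]_(rdegree V, rdegree M)) (q : 'M[k]_(rdegree M, rdegree V)),
    [/\ grepr_hom i, grepr_hom q & i *m q = 1%:M].

Lemma summand_daddl (V M : kGmod) : summand V (dadd_grepr V M).
Proof.
exists (row_mx 1%:M 0), (col_mx 1%:M 0); split.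
- move=> g Gg /=; rewrite mul_mx_row mul_row_block.
  by rewrite !(mulmx0, mul0mx, mul1mx, mulmx1) !addr0.
- move=> g Gg /=; rewrite mul_block_col mul_col_mx.
  by rewrite !(mulmx0, mul0mx, mul1mx, mulmx1) !addr0.
by rewrite mul_row_col mulmx1 mulmx0 addr0.
Qed.

Lemma summand_daddr (V X M : kGmod) : summand V M -> summand V (dadd_grepr X M).
Proof.
case=> i [q [hi hq iq]]; exists (row_mx 0 i), (col_mx 0 q); split.
- move=> g Gg /=; rewrite mul_mx_row mul_row_block hi //.
  by rewrite !(mulmx0, mul0mx) !add0r.
- move=> g Gg /=; rewrite mul_block_col mul_col_mx hq //.
  by rewrite !(mulmx0, mul0mx) !add0r.
by rewrite mul_row_col mulmx0 add0r.
Qed.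

Lemma summand_big (I : eqType) (r : seq I) (F : I -> kGmod) s :
  s \in r -> summand (F s) (\big[@dadd_grepr k gT G/grepr0]_(t <- r) F t).
Proof.
elim: r => // t r IH; rewrite inE big_cons => /orP[/eqP-> | /IH].
  exact: summand_daddl.
exact: summand_daddr.
Qed.

Section Relative.

Variable M : kGmod.

(** The ideal defining the stable category: a homomorphism X -> Y factors
    through a relatively M-projective module exactly when it is the partial
    trace of a homomorphism M (x) X -> M (x) Y.  In this form closure under
    sums, compositions and tensor products is immediate. *)
Definition trace_ideal X Y (h : 'M[k]_(rdegree X, rdegree Y)) : Prop :=
  exists2 t : 'M[k]_(rdegree M * rdegree X, rdegree M * rdegree Y),
    @grepr_hom k gT G (tensor_grepr M X) (tensor_grepr M Y) t & h = ptrace t.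

Lemma trace_ideal0 X Y : @trace_ideal X Y 0.
Proof.
exists 0; first exact: hom0.
by apply/matrixP=> x y; rewrite !mxE big1 // => i _; rewrite mxE.
Qed.

Lemma trace_idealD X Y (h h' : 'M_(rdegree X, rdegree Y)) :
  trace_ideal h -> trace_ideal h' -> trace_ideal (h + h').
Proof.
case=> t ht -> [t' ht' ->].
by exists (t + t'); [apply: homD | rewrite ptraceD].
Qed.

Lemma trace_idealMl X Y Z (f : 'M_(rdegree Z, rdegree X))
    (h : 'M_(rdegree X, rdegree Y)) :
  grepr_hom f -> trace_ideal h -> trace_ideal (f *m h).
Proof.
move=> hf [t ht ->]; exists (tprod 1%:M f *m t); last by rewrite ptraceMl.
exact: (homM (hom_tprod (hom1 M) hf) ht).
Qed.

Lemma trace_idealMr X Y Z (f : 'M_(rdegree Y, rdegree Z))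
    (h : 'M_(rdegree X, rdegree Y)) :
  grepr_hom f -> trace_ideal h -> trace_ideal (h *m f).
Proof.
move=> hf [t ht ->]; exists (t *m tprod 1%:M f); last by rewrite ptraceMr.
exact: (homM ht (hom_tprod (hom1 M) hf)).
Qed.

(** Moving the action on M around the trace cancels it, so only the actions
    on X and Y remain. *)
Lemma hom_ptrace X Y (t : 'M[k]_(rdegree M * rdegree X, rdegree M * rdegree Y)) :
  @grepr_hom k gT G (tensor_grepr M X) (tensor_grepr M Y) t ->
  @grepr_hom k gT G X Y (ptrace t).
Proof.
move=> ht g Gg; have := ht g Gg; rewrite /= => e.
have -> : X g *m ptrace t
    = ptrace (tprod (M g^-1%g) (1%:M : 'M_(rdegree X)) *m
                (t *m tprod (M g) (Y g))).
  rewrite -ptraceMl -e mulmxA -tprodE mul1mx -repr_mxM ?groupV //.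
  by rewrite mulVg repr_mx1.
rewrite ptrace_cyclic -mulmxA -tprodE mulmx1 -repr_mxM ?groupV //.
by rewrite mulgV repr_mx1 ptraceMr.
Qed.

(** The flip u (x) v (x) z |-> v (x) u (x) z of V (x) V (x) Z has partial trace
    the identity of V (x) Z, and V may be replaced by a module containing it
    as a summand. *)
Lemma trace_ideal_summand V Z : summand V M ->
  @trace_ideal (tensor_grepr V Z) (tensor_grepr V Z) 1%:M.
Proof.
case=> i [q [hi hq iq]].
pose v := rdegree V; pose z := rdegree Z.
pose flip (u : 'I_(v * (v * z))) : 'I_(v * (v * z)) :=
  tidx (tfst (tsnd u)) (tidx (tfst u) (tsnd (tsnd u))).
have flipE a b c : flip (tidx a (tidx b c)) = tidx b (tidx a c).
  by rewrite /flip !(tfstK, tsndK).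
have flipK : involutive flip.
  by apply: tidx_ind => a; apply: tidx_ind => b c; rewrite !flipE.
exists (tprod q 1%:M *m (fun_mx k flip *m tprod i 1%:M)).
  apply: (homM (hom_tprod hq (hom1 (tensor_grepr V Z)))).
  apply: (homM _ (hom_tprod hi (hom1 (tensor_grepr V Z)))).
  apply: hom_fun_mx; first exact: inv_bij.
  move=> g _; apply: tidx_ind => a; apply: tidx_ind => b c.
  apply: tidx_ind => a'; apply: tidx_ind => b' c'.
  by rewrite /= !flipE !tprod_tidx mulrCA.
rewrite ptrace_cyclic -mulmxA -tprodE iq mulmx1 tprod1 mulmx1.
apply/matrixP; apply: tidx_ind => b c; apply: tidx_ind => b' c'.
rewrite !mxE eq_tidx (bigD1 b) //= mxE flipE !eq_tidx eqxx /=.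
rewrite big1 ?addr0 // => a ne; rewrite mxE flipE !eq_tidx.
by rewrite eq_sym (negbTE ne).
Qed.

Lemma trace_ideal_factor V X Y Z
    (a : 'M_(rdegree X, rdegree (tensor_grepr V Z)))
    (b : 'M_(rdegree (tensor_grepr V Z), rdegree Y)) :
  summand V M -> grepr_hom a -> grepr_hom b -> trace_ideal (a *m b).
Proof.
move=> sV ha hb; rewrite -(mul1mx b); apply: trace_idealMl => //.
by apply: trace_idealMr => //; apply: trace_ideal_summand.
Qed.

(** Tensoring with M splits Y -> P by some s; if the identity of P is the
    partial trace of t, then the partial trace of t *m s splits Y -> P. *)
Lemma rel_projective_trace P :
  @trace_ideal P P 1%:M -> rel_projective M P.
Proof.
case=> t ht e X Y f g [_ hg _ _ _] [s hs sg].
exists (ptrace (t *m s)); first exact: (hom_ptrace (homM ht hs)).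
by rewrite -ptraceMr -mulmxA [s *m _]sg mulmx1.
Qed.

(** A partial trace factors as X -> M (x) M^* (x) Y -> Y, the second map being
    evaluation. *)
Lemma factors_trace X Y (h : 'M_(rdegree X, rdegree Y)) :
  trace_ideal h -> factors_rel_projective M h.
Proof.
case=> t ht ->; pose m := rdegree M; pose y := rdegree Y.
pose a : 'M[k]_(rdegree X, m * (m * y)) := \matrix_(x, u)
  t (tidx (tfst (tsnd u)) x) (tidx (tfst u) (tsnd (tsnd u))).
pose b : 'M[k]_(m * (m * y), y) := \matrix_(u, w)
  ((tfst u == tfst (tsnd u))%:R * (tsnd (tsnd u) == w)%:R).
(* t is the composite of a with the evaluation b: its input index in M becomes
   the index j in the dual of M, its output index in M becomes i. *)
have aE x i j w : a x (tidx i (tidx j w)) = t (tidx j x) (tidx i w).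
  by rewrite mxE !(tfstK, tsndK).
have bE i j w w' : b (tidx i (tidx j w)) w' = (i == j)%:R * (w == w')%:R.
  by rewrite mxE !(tfstK, tsndK).
exists (tensor_grepr M (tensor_grepr (Representation (dual_repr M)) Y)), a, b.
split.
- apply: rel_projective_trace; apply: trace_ideal_summand.
  by exists 1%:M, 1%:M; rewrite mulmx1; split=> //; apply: hom1.
- move=> g Gg; apply/matrixP=> x; apply: tidx_ind => i; apply: tidx_ind => j w.
  have e : tprod 1%:M (X g) *m t
      = tprod (M g^-1%g) 1%:M *m (t *m tprod (M g) (Y g)).
    rewrite -[t *m _](ht g Gg) /= mulmxA -tprodE -repr_mxM ?groupV //.
    by rewrite mulVg repr_mx1 mul1mx.
  have := congr1 (fun A : 'M_(_, _) => A (tidx j x) (tidx i w)) e.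
  rewrite !mxE !big_tidx (bigD1 j) //= [X in _ + X]big1 ?addr0; last first.
    move=> j' ne; apply: big1 => x' _.
    by rewrite tprod_tidx mxE eq_sym (negbTE ne) !mul0r.
  under eq_bigr => x' _ do rewrite tprod_tidx mxE eqxx mul1r.
  under [LHS]eq_bigr => x' _ do rewrite -aE.
  move->; under [LHS]eq_bigr => j' _.
    rewrite (bigD1 x) //= [X in _ + X]big1 ?addr0; last first.
      by move=> x' ne; rewrite tprod_tidx mxE eq_sym (negbTE ne) mulr0 mul0r.
    rewrite tprod_tidx mxE eqxx mulr1 mxE big_tidx mulr_sumr.
    over.
  rewrite exchange_big; apply: eq_bigr => i' _; rewrite big_tidx.
  apply: eq_bigr => j' _; rewrite mulr_sumr; apply: eq_bigr => w' _.
  by rewrite aE !tprod_tidx mxE mulrCA [X in _ * X]mulrCA.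
- move=> g Gg; apply/matrixP; apply: tidx_ind => i; apply: tidx_ind => j w w'.
  rewrite !mxE big_tidx.
  under eq_bigr => i' _.
    rewrite big_tidx (bigD1 i') //= [X in _ + X]big1 ?addr0; last first.
      move=> j' ne; apply: big1 => w1 _.
      by rewrite bE eq_sym (negbTE ne) mul0r mulr0.
    rewrite (bigD1 w') //= [X in _ + X]big1 ?addr0; last first.
      by move=> w1 ne; rewrite bE (negbTE ne) !mulr0.
    rewrite bE !eqxx mulr1 mulr1 !tprod_tidx mxE mulrA.
    over.
  rewrite -mulr_suml (bigD1 w) //= [X in _ = _ + X]big1 ?addr0; last first.
    by move=> w1 ne; rewrite bE [w == _]eq_sym (negbTE ne) mulr0 mul0r.
  rewrite bE eqxx mulr1; congr (_ * _).
  have := congr1 (fun A : 'M_(_, _) => A i j) (repr_mxM M Gg (groupVr Gg)).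
  by rewrite mulgV repr_mx1 !mxE => ->.
apply/matrixP=> x w; rewrite !mxE big_tidx; apply: eq_bigr => i _.
rewrite big_tidx (bigD1 i) //= [X in _ + X]big1 ?addr0; last first.
  move=> j ne; apply: big1 => w1 _.
  by rewrite bE eq_sym (negbTE ne) mul0r mulr0.
rewrite (bigD1 w) //= [X in _ + X]big1 ?addr0; last first.
  by move=> w1 ne; rewrite bE (negbTE ne) !mulr0.
by rewrite bE aE !eqxx !mulr1.
Qed.

Definition trace_iso X Y : Prop :=
  exists (f : 'M[k]_(rdegree X, rdegree Y)) (g : 'M[k]_(rdegree Y, rdegree X)),
    [/\ grepr_hom f, grepr_hom g,
        @trace_ideal X X (f *m g - 1%:M) & @trace_ideal Y Y (g *m f - 1%:M)].

Lemma stable_iso_trace X Y : trace_iso X Y -> stable_iso M X Y.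
Proof.
by case=> f [g [hf hg h1 h2]]; exists f, g; split=> //; apply: factors_trace.
Qed.

Lemma trace_iso_sym X Y : trace_iso X Y -> trace_iso Y X.
Proof. by case=> f [g [hf hg h1 h2]]; exists g, f. Qed.

Lemma trace_iso_trans Y X Z : trace_iso X Y -> trace_iso Y Z -> trace_iso X Z.
Proof.
have step (A B C : kGmod) (f : 'M_(rdegree A, rdegree B)) g
    (f' : 'M_(rdegree B, rdegree C)) g' :
    grepr_hom f -> grepr_hom g ->
    @trace_ideal A A (f *m g - 1%:M) -> @trace_ideal B B (f' *m g' - 1%:M) ->
    @trace_ideal A A ((f *m f') *m (g' *m g) - 1%:M).
  move=> hf hg h1 h2.
  have -> : f *m f' *m (g' *m g) - 1%:M
      = f *m ((f' *m g' - 1%:M) *m g) + (f *m g - 1%:M).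
    by rewrite mulmxBl mul1mx mulmxBr addrA subrK !mulmxA.
  by apply: trace_idealD => //; apply/trace_idealMl/trace_idealMr.
case=> f [g [hf hg h1 h2]] [f' [g' [hf' hg' h1' h2']]].
exists (f *m f'), (g' *m g); split.
- exact: homM hf hf'.
- exact: homM hg' hg.
- exact: step.
- exact: step.
Qed.

Lemma iso_trace_iso X Y (f : 'M_(rdegree X, rdegree Y))
    (g : 'M_(rdegree Y, rdegree X)) :
  grepr_hom f -> grepr_hom g -> f *m g = 1%:M -> g *m f = 1%:M ->
  trace_iso X Y.
Proof.
move=> hf hg fg gf; exists f, g.
by split=> //; rewrite (fg, gf) subrr; apply: trace_ideal0.
Qed.

Lemma trace_iso_fun_mx X Y (phi : 'I_(rdegree X) -> 'I_(rdegree Y)) psi :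
  cancel phi psi -> cancel psi phi ->
  {in G, forall g u v, X g u v = Y g (phi u) (phi v)} -> trace_iso X Y.
Proof.
move=> phiK psiK e.
apply: (iso_trace_iso (f := fun_mx k phi) (g := fun_mx k psi)).
- by apply: hom_fun_mx => //; exists psi.
- apply: hom_fun_mx; first by exists phi.
  by move=> g Gg u v; rewrite e // !psiK.
- exact: fun_mxK.
- exact: fun_mxK.
Qed.

Lemma tassoc_repr X Y Z g u v :
  tensor_grepr X (tensor_grepr Y Z) g u v
  = tensor_grepr (tensor_grepr X Y) Z g (tassoc u) (tassoc v).
Proof.
move: u v; apply: tidx_ind => x; apply: tidx_ind => y z.
apply: tidx_ind => x'; apply: tidx_ind => y' z'.
by rewrite !tassocE /= !tprod_tidx mulrA.
Qed.

Lemma trace_iso_assoc X Y Z :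
  trace_iso (tensor_grepr X (tensor_grepr Y Z))
            (tensor_grepr (tensor_grepr X Y) Z).
Proof.
apply: (@trace_iso_fun_mx (tensor_grepr X (tensor_grepr Y Z))
          (tensor_grepr (tensor_grepr X Y) Z) (@tassoc _ _ _) (@tassoc_inv _ _ _)).
- exact: tassocK.
- exact: tassoc_invK.
by move=> g _ u v; apply: tassoc_repr.
Qed.

Lemma trace_iso_comm X Y :
  trace_iso (tensor_grepr X Y) (tensor_grepr Y X).
Proof.
have swapK a b : cancel (fun u : 'I_(a * b) => tidx (tsnd u) (tfst u))
                        (fun u : 'I_(b * a) => tidx (tsnd u) (tfst u)).
  by move=> u; rewrite tfstK tsndK tidxK.
apply: (@trace_iso_fun_mx (tensor_grepr X Y) (tensor_grepr Y X) _ _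
          (@swapK _ _) (@swapK _ _)) => g _.
apply: tidx_ind => x y; apply: tidx_ind => x' y'.
by rewrite /= !(tfstK, tsndK) !tprod_tidx mulrC.
Qed.

(** The partial trace of t (x) 1, reassociated, is (ptrace t) (x) 1. *)
Lemma trace_ideal_tensor X Y Z (h : 'M_(rdegree X, rdegree Y)) :
  trace_ideal h ->
  @trace_ideal (tensor_grepr X Z) (tensor_grepr Y Z) (tprod h 1%:M).
Proof.
case=> t ht ->.
exists (fun_mx k (@tassoc _ _ _) *m tprod t (1%:M : 'M_(rdegree Z))
          *m fun_mx k (@tassoc_inv _ _ _)).
  apply: (@homM _ (tensor_grepr (tensor_grepr M Y) Z)).
    apply: (@homM _ (tensor_grepr (tensor_grepr M X) Z)).
      apply: hom_fun_mx => [|g _ u v]; last exact: tassoc_repr.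
      by exists (@tassoc_inv _ _ _); [apply: tassocK | apply: tassoc_invK].
    exact: (hom_tprod ht (hom1 Z)).
  apply: hom_fun_mx => [|g _ u v]; last by rewrite tassoc_repr !tassoc_invK.
  by exists (@tassoc _ _ _); [apply: tassoc_invK | apply: tassocK].
apply: tensor_ext => x z y z'; rewrite tprod_tidx !mxE mulr_suml.
apply: eq_bigr => i _.
rewrite -[in RHS](tassocK (tidx i (tidx y z'))) mul_fun_mx.
  by rewrite fun_mxE !tassocE tprod_tidx mxE.
exact: can_inj (@tassoc_invK _ _ _).
Qed.

Lemma trace_iso_tensorl X Y Z :
  trace_iso X Y -> trace_iso (tensor_grepr X Z) (tensor_grepr Y Z).
Proof.
have step (A B : kGmod) (f : 'M_(rdegree A, rdegree B)) g :
    @trace_ideal A A (f *m g - 1%:M) ->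
    @trace_ideal (tensor_grepr A Z) (tensor_grepr A Z)
      (tprod f 1%:M *m tprod g 1%:M - 1%:M).
  move=> h; suff -> : tprod f 1%:M *m tprod g 1%:M - 1%:M
      = tprod (f *m g - 1%:M) (1%:M : 'M_(rdegree Z)).
    exact: trace_ideal_tensor.
  rewrite tprodDl -(scaleN1r (1%:M : 'M_(rdegree A))) tprodZl scaleN1r tprod1.
  by rewrite -tprodE mulmx1.
case=> f [g [hf hg h1 h2]]; exists (tprod f 1%:M), (tprod g 1%:M).
split; [exact: (hom_tprod hf (hom1 Z)) | exact: (hom_tprod hg (hom1 Z))
       | exact: step | exact: step].
Qed.

Lemma trace_iso_tensorr X Y Z :
  trace_iso X Y -> trace_iso (tensor_grepr Z X) (tensor_grepr Z Y).
Proof.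
move=> h; apply: trace_iso_trans (trace_iso_comm Z X) _.
by apply: trace_iso_trans (trace_iso_tensorl _ h) (trace_iso_comm Y Z).
Qed.

End Relative.

End StableCategory.

(** * Operators between symmetric powers *)

Section Operators.

Variables (k : fieldType) (n : nat).
Implicit Types (p q : {mpoly k[n]}) (d e : nat).

Definition opmx d e (T : {mpoly k[n]} -> {mpoly k[n]}) :
    'M[k]_(#|sym_basis n d|, #|sym_basis n e|) :=
  \matrix_(i, j) (T 'X_[sym_monom i])@_(sym_monom j).

Lemma mdeg_sym_monom d (i : 'I_#|sym_basis n d|) : mdeg (sym_monom i) = d.
Proof. by have := enum_valP i; rewrite inE => /eqP. Qed.

Lemma sym_monom_inj d : injective (@sym_monom n d).
Proof. by move=> i j /val_inj/enum_val_inj. Qed.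

Lemma homog_sym_monom d (i : 'I_#|sym_basis n d|) :
  'X_[k, sym_monom i] \is d.-homog.
Proof. by rewrite dhomogX /= mdeg_sym_monom. Qed.

Lemma homog_expand d q : q \is d.-homog ->
  q = \sum_(l < #|sym_basis n d|) q@_(sym_monom l) *: 'X_[sym_monom l].
Proof.
move=> hq; have szq : (msize q <= d.+1)%N.
  rewrite msizeE; apply/bigmax_leqP_seq => m mq _.
  by rewrite (dhomogP mdeg d q hq m mq).
rewrite [LHS](mpolywE szq) (bigID (mem (sym_basis n d))) /=.
rewrite [X in _ + X]big1 ?addr0; first by rewrite big_enum_val.
by move=> m; rewrite inE => ne; rewrite (dhomog_nemf_coeff hq) // scale0r.
Qed.

Lemma linear_comb (T : {mpoly k[n]} -> {mpoly k[n]}) (I : finType)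
    (c : I -> k) (x : I -> {mpoly k[n]}) :
  linear T -> T (\sum_i c i *: x i) = \sum_i c i *: T (x i).
Proof.
move=> linT; have T0 : T 0 = 0.
  by have := linT (-1) 0 0; rewrite scaler0 addr0 scaleN1r addNr.
by elim: (index_enum _) => [|i r IH]; rewrite ?big_nil // !big_cons linT IH.
Qed.

Lemma opmxM d e f (T T' : {mpoly k[n]} -> {mpoly k[n]}) :
  linear T' -> (forall p, p \is d.-homog -> T p \is e.-homog) ->
  opmx d e T *m opmx e f T' = opmx d f (T' \o T).
Proof.
move=> linT' hT; apply/matrixP=> i j; rewrite !mxE /=.
have hq := hT _ (homog_sym_monom i).
rewrite [in RHS](homog_expand hq) linear_comb // linear_sum /=.
by apply: eq_bigr => l _; rewrite !mxE mcoeffZ.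
Qed.

Lemma mulX_linear (a : 'I_n) : linear (fun p : {mpoly k[n]} => 'X_a * p).
Proof. by move=> c p q; rewrite mulrDr scalerAr. Qed.

Lemma eq_opmx d e T T' :
  (forall p, p \is d.-homog -> T p = T' p) -> opmx d e T = opmx d e T'.
Proof. by move=> h; apply/matrixP=> i j; rewrite !mxE h ?homog_sym_monom. Qed.

Lemma opmx_sum d e (I : finType) (c : I -> k) (T : I -> _ -> {mpoly k[n]}) :
  opmx d e (fun p => \sum_i c i *: T i p) = \sum_i c i *: opmx d e (T i).
Proof.
apply/matrixP=> i j; rewrite summxE !mxE linear_sum.
by apply: eq_bigr => a _; rewrite /= !mxE linearZ.
Qed.

Lemma opmx_scalar d c : opmx d d (fun p => c *: p) = c%:M.
Proof.
apply/matrixP=> i j; rewrite !mxE linearZ /= mcoeffX (inj_eq (@sym_monom_inj d)).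
by rewrite mulr_natr.
Qed.

Lemma homogX d (a : 'I_n) p : p \is d.-homog -> 'X_a * p \is d.+1.-homog.
Proof.
by move=> hp; rewrite -add1n; apply: dhomogM; rewrite // dhomogX /= mdeg1.
Qed.

Lemma homog_mderiv d (a : 'I_n) p : p \is d.+1.-homog -> p^`M(a) \is d.-homog.
Proof.
move/homog_expand=> ->; rewrite linear_sum; apply: rpred_sum => l _.
rewrite linearZ /=; apply: dhomogZ; rewrite mderivX.
have [-> | nz] := eqVneq (sym_monom l a) 0%N.
  by rewrite scale0r; apply: dhomog0.
apply: dhomogZ; rewrite dhomogX /=.
have le : (U_(a) <= sym_monom l)%MM by rewrite lep1mP.
have := congr1 mdeg (submK le).
by rewrite mdegD mdeg1 addn1 mdeg_sym_monom => -[->].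
Qed.

Lemma comp_linear (A : 'M_n) :
  linear (fun p : {mpoly k[n]} => p \mPo sym_subst A).
Proof. by move=> c p q; rewrite comp_mpolyD comp_mpolyZ. Qed.

Lemma homog_comp d (A : 'M_n) p :
  p \is d.-homog -> p \mPo sym_subst A \is d.-homog.
Proof.
move/homog_expand=> ->; rewrite linear_sum; apply: rpred_sum => l _.
rewrite linearZ /=; apply: dhomogZ.
by have := sym_subst_homog A (sym_monom l); rewrite mdeg_sym_monom.
Qed.

Lemma euler d p : p \is d.-homog -> \sum_a 'X_a * p^`M(a) = d%:R *: p.
Proof.
move/homog_expand=> ->.
under eq_bigr => a _ do rewrite linear_sum mulr_sumr.
rewrite exchange_big scaler_sumr; apply: eq_bigr => l _ /=.
rewrite scalerA mulrC -scalerA.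
under eq_bigr => a _ do rewrite linearZ /= -scalerAr.
rewrite -scaler_sumr; congr (_ *: _).
transitivity (\sum_a (sym_monom l a)%:R *: 'X_[k, sym_monom l]).
  apply: eq_bigr => a _; rewrite mderivX -scalerAr.
  have [-> | nz] := eqVneq (sym_monom l a) 0%N; first by rewrite !scale0r.
  have le : (U_(a) <= sym_monom l)%MM by rewrite lep1mP.
  by rewrite -mpolyXD addmC submK.
by rewrite -scaler_suml -natr_sum -mdegE mdeg_sym_monom.
Qed.

Lemma mpolyX_ind (P : {mpoly k[n]} -> Prop) (m : 'X_{1..n}) :
  P 1 -> (forall p q, P p -> P q -> P (p * q)) -> (forall a, P 'X_a) ->
  P 'X_[m].
Proof.
move=> P1 PM PX; rewrite mpolyXE_id; elim/big_rec: _ => // a p _ Pp.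
apply: (PM) Pp; elim: (m a) => [|r IHr]; first by rewrite expr0.
by rewrite exprS; apply: PM.
Qed.

(** The chain rule.  The polynomials satisfying it form a subalgebra, which
    contains the variables. *)
Lemma mderiv_comp (A : 'M_n) (a : 'I_n) p :
  (p \mPo sym_subst A)^`M(a)
  = \sum_b A b a *: (p^`M(b) \mPo sym_subst A).
Proof.
pose chain q := (q \mPo sym_subst A)^`M(a)
  = \sum_b A b a *: (q^`M(b) \mPo sym_subst A).
have chainM q q' : chain q -> chain q' -> chain (q * q').
  rewrite /chain => h h'; rewrite rmorphM /= mderivM h h'.
  rewrite mulr_suml mulr_sumr -big_split; apply: eq_bigr => b _ /=.
  by rewrite mderivM rmorphD !rmorphM /= scalerDr scalerAl scalerAr.
have chain1 : chain 1.
  rewrite /chain rmorph1 -mpolyC1 mderivC big1 // => b _.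
  by rewrite mderivC rmorph0 scaler0.
have chainX b : chain 'X_b.
  rewrite /chain comp_mpolyXU -tnth_nth tnth_mktuple linear_sum /=.
  rewrite (bigD1 a) //= [X in _ + X]big1 ?addr0 => [|c ne]; last first.
    by rewrite linearZ /= mderivX mnm1E (negbTE ne) scale0r scaler0.
  rewrite (bigD1 b) //= [X in _ = _ + X]big1 ?addr0 => [|c ne]; last first.
    by rewrite mderivX mnm1E eq_sym (negbTE ne) scale0r rmorph0 scaler0.
  rewrite linearZ /= !mderivX !mnm1E !eqxx !scale1r; congr (_ *: _).
  have sub1 (c : 'I_n) : (U_(c) - U_(c) = 0)%MM.
    by apply/mnmP => x; rewrite mnmBE mnm0E subnn.
  by rewrite !sub1 !mpolyX0 rmorph1.
rewrite -/(chain p); elim/mpolyind: p => [|c m p _ _ IH].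
  by rewrite /chain rmorph0 mderiv0 big1 // => b _; rewrite mderiv0 rmorph0 scaler0.
have hm : chain 'X_[m] by apply: mpolyX_ind.
rewrite /chain comp_mpolyD comp_mpolyZ mderivD mderivZ hm IH scaler_sumr.
rewrite -big_split; apply: eq_bigr => b _ /=.
by rewrite mderivD mderivZ comp_mpolyD comp_mpolyZ scalerDr !scalerA mulrC.
Qed.

(** Multiplication by a variable, differentiation, and their composite; the last
    is also defined on constants, where differentiation has no target degree. *)
Definition opX d (a : 'I_n) := opmx d d.+1 (fun p => 'X_a * p).
Definition opD d (a : 'I_n) := opmx d.+1 d (mderiv a).
Definition opN d (a b : 'I_n) := opmx d d (fun p => 'X_a * p^`M(b)).

Lemma opN0 a b : opN 0 a b = 0.
Proof.
apply/matrixP=> i j; rewrite !mxE; have := mdeg_sym_monom i.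
move/eqP; rewrite mdeg_eq0 => /eqP->.
by rewrite mpolyX0 -mpolyC1 mderivC mulr0 mcoeff0.
Qed.

Lemma opDX d a b : opD d b *m opX d a = opN d.+1 a b.
Proof. by apply: opmxM; [apply: mulX_linear | apply: homog_mderiv]. Qed.

Lemma opXD d a b : opX d a *m opD d b = (a == b)%:R%:M + opN d a b.
Proof.
rewrite opmxM; [|exact: mderiv_is_linear|by move=> p; apply: homogX].
rewrite -opmx_scalar; apply/matrixP=> i j; rewrite !mxE -mcoeffD; congr (_@__).
rewrite /= mderivM; congr (_ + _); rewrite mderivX mnm1E.
case: eqP => [->|_]; last by rewrite !scale0r mul0r.
have -> : (U_(b) - U_(b) = 0)%MM by apply/mnmP => x; rewrite mnmBE mnm0E subnn.
by rewrite mpolyX0 scale1r mul1r scale1r.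
Qed.

Lemma opN_trace d : \sum_a opN d a a = d%:R%:M.
Proof.
transitivity (\sum_a 1 *: opN d a a).
  by apply: eq_bigr => a _; rewrite scale1r.
rewrite -opmx_sum -opmx_scalar; apply: eq_opmx => p hp.
by rewrite -(euler hp); apply: eq_bigr => a _; rewrite scale1r.
Qed.

Lemma opX_sym d a (A : 'M_n) :
  opX d a *m sym_mx d.+1 A = \sum_b A a b *: (sym_mx d A *m opX d b).
Proof.
under [RHS]eq_bigr => b _ do
  rewrite (opmxM _ (mulX_linear b) (@homog_comp d A)).
rewrite -opmx_sum (opmxM _ (comp_linear A) (@homogX d a)).
apply: eq_opmx => p _; rewrite /= rmorphM /= comp_mpolyXU -tnth_nth.
by rewrite tnth_mktuple mulr_suml; apply: eq_bigr => b _; rewrite scalerAl.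
Qed.

Lemma opD_sym d a (A : 'M_n) :
  sym_mx d.+1 A *m opD d a = \sum_b A b a *: (opD d b *m sym_mx d A).
Proof.
under [RHS]eq_bigr => b _ do
  rewrite (opmxM _ (comp_linear A) (@homog_mderiv d b)).
rewrite -opmx_sum (opmxM _ (@mderiv_is_linear _ _ a) (@homog_comp d.+1 A)).
by apply: eq_opmx => p _; apply: mderiv_comp.
Qed.

End Operators.

(** * The Capelli identities for two binary forms *)

Section KroneckerIdentities.

Variables (k : fieldType) (a b : nat).

Lemma sum2 (V : nmodType) (F : 'I_2 -> V) : \sum_a F a = F 0 + F 1.
Proof. by rewrite big_ord_recl big_ord1; congr (_ + F _); apply: val_inj. Qed.

Lemma scalar_mx_entry n c (i j : 'I_n) : c%:M i j = c * (i == j)%:R :> k.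
Proof. by rewrite mxE mulr_natr. Qed.

(** The computation behind Capelli's identities.  Here x i j stands for X_i d_j
    on degree m and y i j for the same on degree l, normal ordered; P and Q are
    the same products in the other order, which differ by the Kronecker delta.
    The hypotheses on x 1 1 and y 1 1 are Euler's formula.  The off-diagonal
    terms cancel and the rest is a product of two traces. *)
Lemma capelli_XD (m l : nat) (P x : 'I_2 -> 'I_2 -> 'M[k]_a)
    (Q y : 'I_2 -> 'I_2 -> 'M[k]_b) :
  (forall i j, P i j = (i == j)%:R%:M + x i j) ->
  (forall i j, Q i j = (i == j)%:R%:M + y i j) ->
  x 1 1 = m%:R%:M - x 0 0 -> y 1 1 = l%:R%:M - y 0 0 ->
  tprod (P 0 0) (Q 1 1) - tprod (P 0 1) (Q 1 0)
    - (tprod (P 1 0) (Q 0 1) - tprod (P 1 1) (Q 0 0))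
  = (m.+2 * l.+1)%:R%:M
    - (tprod (P 0 0) (y 0 0) + tprod (P 0 1) (y 1 0)
       + (tprod (P 1 0) (y 0 1) + tprod (P 1 1) (y 1 1))).
Proof.
move=> eP eQ ex ey; rewrite !eP !eQ ex ey; apply: tensor_ext => i j i' j'.
by rewrite !(tprod_tidx, scalar_mx_entry, mxE) eq_tidx -mulnb !natrM /=; ring.
Qed.

Lemma capelli_DX (m l : nat) (P x : 'I_2 -> 'I_2 -> 'M[k]_a)
    (y : 'I_2 -> 'I_2 -> 'M[k]_b) :
  (forall i j, P i j = (i == j)%:R%:M + x i j) ->
  x 1 1 = m.+1%:R%:M - x 0 0 -> y 1 1 = l.+1%:R%:M - y 0 0 ->
  tprod (x 0 0) (y 1 1) - tprod (x 1 0) (y 0 1)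
    - (tprod (x 0 1) (y 1 0) - tprod (x 1 1) (y 0 0))
  = (m.+2 * l.+1)%:R%:M
    - (tprod (P 0 0) (y 0 0) + tprod (P 0 1) (y 1 0)
       + (tprod (P 1 0) (y 0 1) + tprod (P 1 1) (y 1 1))).
Proof.
move=> eP ex ey; rewrite !eP ex ey; apply: tensor_ext => i j i' j'.
by rewrite !(tprod_tidx, scalar_mx_entry, mxE) eq_tidx -mulnb !natrM /=; ring.
Qed.

Variables (a' b' : nat) (A : 'M[k]_2).
Variables (u0 u1 : 'M[k]_(a, a')) (v0 v1 : 'M[k]_(b, b')).

Lemma det_mx22 : \det A = A 0 0 * A 1 1 - A 0 1 * A 1 0.
Proof.
rewrite (expand_det_row _ 0) sum2 /cofactor !det_mx11 !mxE /= expr0 expr1 mul1r.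
rewrite mulN1r mulrN; congr (_ * A _ _ - _ * A _ _); exact: val_inj.
Qed.

Lemma tprod_det : \det A = 1 ->
  tprod (A 0 0 *: u0 + A 0 1 *: u1) (A 1 0 *: v0 + A 1 1 *: v1)
    - tprod (A 1 0 *: u0 + A 1 1 *: u1) (A 0 0 *: v0 + A 0 1 *: v1)
  = tprod u0 v1 - tprod u1 v0.
Proof.
move=> detA; apply: tensor_ext => i j i' j'; rewrite !(tprod_tidx, mxE).
by rewrite -[RHS]mul1r -detA det_mx22; ring.
Qed.

(** Invariance of the pairing of vectors with covectors: variables and
    derivatives transform contragrediently.  This makes the polarizations
    equivariant. *)
Lemma tprod_dual :
  tprod (A 0 0 *: u0 + A 0 1 *: u1) v0 + tprod (A 1 0 *: u0 + A 1 1 *: u1) v1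
  = tprod u0 (A 0 0 *: v0 + A 1 0 *: v1) + tprod u1 (A 0 1 *: v0 + A 1 1 *: v1).
Proof. by apply: tensor_ext => i j i' j'; rewrite !(tprod_tidx, mxE); ring. Qed.

End KroneckerIdentities.

Section Capelli.

Variable k : fieldType.
Implicit Types m l d : nat.

Local Notation N d := #|sym_basis 2 d|.
Local Notation X d a := (opX k d (a : 'I_2)).
Local Notation D d a := (opD k d (a : 'I_2)).

(* Elements of S^m (x) S^l are bihomogeneous polynomials in two vector variables.
   Operators act on row vectors, so A *m B applies A first. *)

(** Multiplication by the determinant of the two vector variables, and the
    Cayley operator. *)
Definition omega m l : 'M[k]_(N m * N l, N m.+1 * N l.+1) :=
  tprod (X m 0) (X l 1) - tprod (X m 1) (X l 0).
Definition cayley m l : 'M[k]_(N m.+1 * N l.+1, N m * N l) :=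
  tprod (D m 0) (D l 1) - tprod (D m 1) (D l 0).

(** The two polarization operators; [polar] is their composite, written so as to
    make sense (and be 0) also when l = 0. *)
Definition polar_up m l : 'M[k]_(N m * N l.+1, N m.+1 * N l) :=
  \sum_a tprod (X m a) (D l a).
Definition polar_down m l : 'M[k]_(N m.+1 * N l, N m * N l.+1) :=
  \sum_a tprod (D m a) (X l a).
Definition polar m l : 'M[k]_(N m * N l) :=
  \sum_a \sum_b tprod (X m a *m D m b) (opN k l b a).

Lemma polar0 m : polar m 0 = 0.
Proof.
rewrite /polar big1 // => a _; rewrite big1 // => b _.
by rewrite opN0 -(scale0r (0 : 'M_(N 0))) tprodZr scale0r.
Qed.

Lemma polarS m l : polar m l.+1 = polar_up m l *m polar_down m l.
Proof.
rewrite /polar_up mulmx_suml; apply: eq_bigr => a _.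
rewrite mulmx_sumr; apply: eq_bigr => b _.
by rewrite -tprodE opDX.
Qed.

Lemma opN11 d : opN k d (1 : 'I_2) 1 = d%:R%:M - opN k d 0 0.
Proof. by rewrite -opN_trace sum2 addrAC subrr add0r. Qed.

Lemma omega_cayley m l :
  omega m l *m cayley m l = (m.+2 * l.+1)%:R%:M - polar m l.
Proof.
rewrite /omega /cayley /polar !sum2 mulmxBl !mulmxBr -!tprodE.
apply: (capelli_XD (P := fun a b => X m a *m D m b)
                   (Q := fun a b => X l a *m D l b) (x := opN k m) (y := opN k l)).
- exact: opXD.
- exact: opXD.
- exact: opN11.
- exact: opN11.
Qed.

Lemma cayley_omega m l :
  cayley m l *m omega m l = (m.+2 * l.+1)%:R%:M - polar m.+1 l.+1.
Proof.
rewrite /omega /cayley /polar !sum2 mulmxBl !mulmxBr -!tprodE !opDX.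
apply: (capelli_DX (P := fun a b => X m.+1 a *m D m.+1 b)
                   (x := opN k m.+1) (y := opN k l.+1)).
- exact: opXD.
- exact: opN11.
- exact: opN11.
Qed.

(** Both sides are determined by omega and cayley through Capelli's identities,
    with the same scalar. *)
Lemma omega_polar m l : omega m l *m polar m.+1 l.+1 = polar m l *m omega m l.
Proof.
have e : polar m.+1 l.+1 = (m.+2 * l.+1)%:R%:M - cayley m l *m omega m l.
  by rewrite cayley_omega opprB addrC subrK.
have e' : polar m l = (m.+2 * l.+1)%:R%:M - omega m l *m cayley m l.
  by rewrite omega_cayley opprB addrC subrK.
have gen a b (U : 'M[k]_(a, b)) C c : U *m (c%:M - C *m U) = (c%:M - U *m C) *m U.
  by rewrite mulmxBr mulmxBl mulmxA mul_mx_scalar mul_scalar_mx.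
by rewrite e e' gen.
Qed.

Section Equivariance.

Variables (A : 'M[k]_2) (detA : \det A = 1).
Local Notation S d := (sym_mx d A).

Lemma omega_sym m l :
  tprod (S m) (S l) *m omega m l = omega m l *m tprod (S m.+1) (S l.+1).
Proof.
rewrite /omega mulmxBr mulmxBl -!tprodE !opX_sym !sum2.
by rewrite tprod_det.
Qed.

Lemma cayley_sym m l :
  tprod (S m.+1) (S l.+1) *m cayley m l = cayley m l *m tprod (S m) (S l).
Proof.
have detAT : \det A^T = 1 by rewrite det_tr.
rewrite /cayley mulmxBr mulmxBl -!tprodE !opD_sym !sum2.
have trE i j : A i j = A^T j i by rewrite mxE.
by rewrite ![A _ _]trE tprod_det.
Qed.

Lemma polar_up_sym m l :
  tprod (S m) (S l.+1) *m polar_up m l = polar_up m l *m tprod (S m.+1) (S l).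
Proof.
rewrite /polar_up !sum2 mulmxDr mulmxDl -!tprodE !opX_sym !opD_sym !sum2.
by rewrite tprod_dual.
Qed.

Lemma polar_down_sym m l :
  tprod (S m.+1) (S l) *m polar_down m l
  = polar_down m l *m tprod (S m) (S l.+1).
Proof.
rewrite /polar_down !sum2 mulmxDr mulmxDl -!tprodE !opX_sym !opD_sym !sum2.
have trE i j : A i j = A^T j i by rewrite mxE.
by rewrite ![A _ _]trE tprod_dual.
Qed.

End Equivariance.

End Capelli.

(** * Stable Clebsch-Gordan isomorphisms *)

Section Dual.

Variables (k : fieldType) (gT : finGroupType) (G : {group gT}).
Local Notation kGmod := (representation k G).

(** det (W g) is a p-th root of unity in characteristic p. *)
Lemma det_abelem p n (W : mx_representation k G n) :
  p \in [pchar k] -> p.-abelem%g G -> {in G, forall g, \det (W g) = 1}.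
Proof.
move=> chp abelG g Gg; have prp := pcharf_prime chp.
have expG : (g ^+ p = 1)%g by have /(abelemP prp)[_ ->] := abelG.
 apply/eqP; rewrite -subr_eq0.
suff : (\det (W g) - 1) ^+ p == 0 by rewrite expf_eq0 => /andP[].
rewrite -(pFrobenius_autE chp) rmorphB rmorph1 /= pFrobenius_autE.
have detX m : \det (W g) ^+ m = \det (W (g ^+ m)%g).
  elim: m => [|m IH]; first by rewrite expr0 expg0 repr_mx1 det1.
  by rewrite exprS expgS repr_mxM ?groupX // det_mulmx IH.
by rewrite detX expG repr_mx1 det1 subrr.
Qed.

(** Transposition turns a homomorphism into one between the duals; the dual of a
    tensor product is the tensor product of the duals, on the nose. *)
Lemma hom_dual (X X' Y Y' : kGmod)
    (f : 'M[k]_(rdegree X * rdegree X', rdegree Y * rdegree Y')) :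
  @grepr_hom k gT G (tensor_grepr X X') (tensor_grepr Y Y') f ->
  @grepr_hom k gT G
    (tensor_grepr (Representation (dual_repr Y)) (Representation (dual_repr Y')))
    (tensor_grepr (Representation (dual_repr X)) (Representation (dual_repr X')))
    f^T.
Proof.
move=> hf g Gg; have := hf _ (groupVr Gg) => /= e.
by rewrite -!trmx_tprod -!trmx_mul e.
Qed.

End Dual.

(** The inductive step of [clebsch_gordan].  Since T kills the image of E, it
    does not disturb the composite starting with E; in the other composite it
    commutes past U, so the error stays a right multiple of T'. *)
Lemma capelli_step (k : fieldType) x y z (U : 'M[k]_(x, y)) (C : 'M[k]_(y, x))
    (T : 'M[k]_x) (T' : 'M[k]_y) (F : 'M[k]_(x, z)) (E : 'M[k]_(z, x)) a s c :
  U *m C = s%:M - T -> C *m U = s%:M - T' -> U *m T' = T *m U ->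
  F *m E = c%:M + a *m T -> E *m F = c%:M -> E *m T = 0 ->
  [/\ (C *m F) *m (E *m U) = (s * c)%:M + (C *m a *m U - c%:M) *m T',
      (E *m U) *m (C *m F) = (s * c)%:M & (E *m U) *m T' = 0].
Proof.
move=> UC CU UT FE EF ET; split.
- rewrite -mulmxA (mulmxA F) FE mulmxDl mulmxDr mul_scalar_mx -scalemxAr CU.
  rewrite mulmxBl -[C *m a *m U *m T']mulmxA UT !mulmxA mul_scalar_mx scalerBr.
  by rewrite scale_scalar_mx (mulrC c) -addrA (addrC (- _)).
- rewrite -mulmxA (mulmxA U) UC mulmxBl mulmxBr mul_scalar_mx -scalemxAr EF.
  by rewrite mulmxA ET mul0mx subr0 scale_scalar_mx.
by rewrite -mulmxA UT mulmxA ET mul0mx.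
Qed.

Section Symmetric.

Variables (k : fieldType) (gT : finGroupType) (G : {group gT}).
Variables (W : mx_representation k G 2).
Hypothesis detW : {in G, forall g, \det (W g) = 1}.
Local Notation kGmod := (representation k G).
Local Notation S d := (Representation (sym_repr W d)).
Local Notation N d := #|sym_basis 2 d|.

Lemma hom_omega m l : @grepr_hom k gT G
  (tensor_grepr (S m) (S l)) (tensor_grepr (S m.+1) (S l.+1)) (omega k m l).
Proof. by move=> g Gg; apply: omega_sym; apply: detW. Qed.

Lemma hom_cayley m l : @grepr_hom k gT G
  (tensor_grepr (S m.+1) (S l.+1)) (tensor_grepr (S m) (S l)) (cayley k m l).
Proof. by move=> g Gg; apply: cayley_sym; apply: detW. Qed.

Lemma hom_polar_up m l : @grepr_hom k gT G
  (tensor_grepr (S m) (S l.+1)) (tensor_grepr (S m.+1) (S l)) (polar_up k m l).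
Proof. by move=> g Gg; apply: polar_up_sym. Qed.

Lemma hom_polar_down m l : @grepr_hom k gT G
  (tensor_grepr (S m.+1) (S l)) (tensor_grepr (S m) (S l.+1)) (polar_down k m l).
Proof. by move=> g Gg; apply: polar_down_sym. Qed.

Definition cg_coef m l : k := (\prod_(t < l) ((m + t).+2 * t.+1))%:R.

(** F is the l-th power of the Cayley operator and E multiplication by the l-th
    power of the determinant.  The error is recorded as a multiple of [polar],
    which vanishes for l = 0 and factors through S^(l+m+1) (x) S^(l-1)
    otherwise. *)
Lemma clebsch_gordan m l :
  exists (F : 'M[k]_(N (l + m) * N l, N m * N 0))
         (E : 'M[k]_(N m * N 0, N (l + m) * N l)) (a : 'M[k]_(N (l + m) * N l)),
  let Sml := tensor_grepr (S (l + m)) (S l) in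
  let Sm0 := tensor_grepr (S m) (S 0) in
  [/\ @grepr_hom k gT G Sml Sm0 F, @grepr_hom k gT G Sm0 Sml E,
      @grepr_hom k gT G Sml Sml a &
   [/\ F *m E = (cg_coef m l)%:M + a *m polar k (l + m) l,
       E *m F = (cg_coef m l)%:M & E *m polar k (l + m) l = 0]].
Proof.
elim: l => [|l [F [E [a [hF hE ha [FE EF ET]]]]]].
  have c1 : cg_coef m 0 = 1 by rewrite /cg_coef big_ord0.
  exists 1%:M, 1%:M, 0; rewrite c1 mulmx1 mul0mx addr0 mul1mx polar0.
  by split=> //; [apply: hom1 | apply: hom1 | apply: hom0].
have [FE' EF' ET'] := capelli_step (omega_cayley k (l + m) l)
  (cayley_omega k (l + m) l) (omega_polar k (l + m) l) FE EF ET.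
have cS : (((l + m).+2 * l.+1)%:R * cg_coef m l = cg_coef m l.+1)%R.
  by rewrite /cg_coef big_ord_recr /= [in RHS]natrM mulrC (addnC m).
rewrite cS in FE' EF'.
exists (cayley k (l + m) l *m F), (E *m omega k (l + m) l),
  (cayley k (l + m) l *m a *m omega k (l + m) l - (cg_coef m l)%:M).
split=> //.
- exact: (homM (@hom_cayley _ _) hF).
- exact: (homM hE (@hom_omega _ _)).
rewrite -scaleN1r scale_scalar_mx -mulmxA -[X in _ + X]scalemx1.
apply: (homD (homM (@hom_cayley _ _) (homM ha (@hom_omega _ _)))).
exact/homZ/hom1.
Qed.

Lemma Vmod1_trivial g : g \in G -> Vmod W 1 g = 1%:M.
Proof.
move=> Gg; rewrite /= -[RHS]trmx1; congr (_^T).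
apply/matrixP=> i j; rewrite !mxE.
have deg0 (u : 'I_(N 0)) : sym_monom u = 0%MM.
  by apply/eqP; rewrite -mdeg_eq0 mdeg_sym_monom.
by rewrite -(inj_eq (@sym_monom_inj 2 0)) !deg0 mpolyX0 rmorph1 mcoeff1 !eqxx.
Qed.

Lemma card_sym_basis0 : N 0 = 1%N.
Proof.
have lt01 : (mdeg (0%MM : 'X_{1..2}) < 1)%N by rewrite mdeg0.
transitivity #|[set BMultinom lt01]|; last exact: cards1.
by apply: eq_card => m; rewrite !inE -val_eqE /= mdeg_eq0.
Qed.

Lemma trace_iso_V1 (M X : kGmod) : trace_iso M (tensor_grepr X (Vmod W 1)) X.
Proof.
have o : 'I_(N 0) by apply: cast_ord (esym card_sym_basis0) ord0.
have uniq0 (u v : 'I_(N 0)) : u = v.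
  by apply: (can_inj (cast_ordK card_sym_basis0)); rewrite !ord1.
apply: (@trace_iso_fun_mx k gT G M (tensor_grepr X (Vmod W 1)) X
          (fun u => tfst u) (fun x => tidx x o)).
- by apply: tidx_ind => x u; rewrite tfstK (uniq0 u o).
- by move=> x; rewrite tfstK.
move=> g Gg; apply: tidx_ind => x u; apply: tidx_ind => y v.
by rewrite /= tprod_tidx !tfstK [X in _ * X](congr1 (fun A : 'M_(N 0) => A u v)
  (Vmod1_trivial Gg)) mxE (uniq0 u v) eqxx mulr1.
Qed.

(** After dualizing, [polar] passes through V_(m+2) (x) V_l. *)
Lemma trace_ideal_polar (M X : kGmod) m l
    (b : 'M_(rdegree (tensor_grepr (Vmod W m.+1) (Vmod W l.+1)), rdegree X)) :
  summand (Vmod W m.+2) M -> grepr_hom b ->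
  @trace_ideal k gT G M (tensor_grepr (Vmod W m.+1) (Vmod W l.+1)) X
    ((polar k m l)^T *m b).
Proof.
move=> sV; case: l b => [|l] b hb.
  by rewrite polar0 trmx0 mul0mx; apply: trace_ideal0.
rewrite polarS trmx_mul -mulmxA.
apply: (trace_ideal_factor (Z := Vmod W l.+1) sV).
  exact: (hom_dual (@hom_polar_down _ _)).
exact: (homM (hom_dual (@hom_polar_up _ _)) hb).
Qed.

Lemma trace_iso_clebsch_gordan (M : kGmod) m l :
  cg_coef m l != 0 -> summand (Vmod W (l + m).+2) M ->
  trace_iso M (tensor_grepr (Vmod W (l + m).+1) (Vmod W l.+1)) (Vmod W m.+1).
Proof.
move=> c0 sM.
apply: (trace_iso_trans _ (trace_iso_V1 M (Vmod W m.+1))).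
have [F [E [a [hF hE ha [FE EF _]]]]] := clebsch_gordan m l.
set c := cg_coef m l in c0 FE EF.
have hF' := hom_dual hF; have hE' := hom_dual hE; have ha' := hom_dual ha.
exists (c^-1 *: E^T), F^T; split.
- exact: (homZ _ hE').
- exact: hF'.
- rewrite -scalemxAl -trmx_mul FE linearD /= tr_scalar_mx scalerDr.
  rewrite scale_scalar_mx mulVf // addrC addKr trmx_mul scalemxAr.
  exact: (trace_ideal_polar sM (homZ _ ha')).
rewrite -scalemxAr -trmx_mul EF tr_scalar_mx scale_scalar_mx mulVf // subrr.
exact: trace_ideal0.
Qed.

(** With m = s p - 2 - l the factor m + t + 2 is s p - (l - t), where
    0 < l - t < p. *)
Lemma cg_coef_neq0 p m l s : p \in [pchar k] ->
  (l < p)%N -> (l + m).+2 = (s * p)%N -> cg_coef m l != 0.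
Proof.
move=> chp lp e; have prp := pcharf_prime chp.
rewrite /cg_coef -(dvdn_pcharf chp) Euclid_dvd_prod // big_has.
apply/hasPn => t _; have tl := ltn_ord t.
rewrite Euclid_dvdM // negb_or; apply/andP; split; last first.
  by rewrite gtnNdvd // (leq_ltn_trans tl).
have -> : (m + t).+2 = (s * p - (l - t))%N.
  rewrite -e -!addSn addnC; lia.
rewrite dvdn_subr ?dvdn_mull //; last lia.
by rewrite gtnNdvd // ?subn_gt0 // (leq_ltn_trans (leq_subr _ _)).
Qed.

(** The case m + l + 2 = s p of the Clebsch-Gordan isomorphism: there the scalar
    is invertible and the error passes through V_(s p) (x) V_l. *)
Lemma trace_iso_reflect (M : kGmod) p s b : p \in [pchar k] ->
  summand (Vmod W (s * p)) M -> (0 < s)%N -> (0 < b < p)%N ->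
  trace_iso M (tensor_grepr (Vmod W (s * p - 1)) (Vmod W b))
              (Vmod W (s * p - b)).
Proof.
move=> chp sM s0 /andP[b0 bp]; have psp : (p <= s * p)%N by rewrite leq_pmull.
have e : (b.-1 + (s * p - b.+1)).+2 = (s * p)%N by lia.
have -> : (s * p - 1)%N = (b.-1 + (s * p - b.+1)).+1 by lia.
have -> : (s * p - b)%N = (s * p - b.+1).+1 by lia.
(* l = b - 1 and m = s p - b - 1, so that l + m = s p - 2. *)
rewrite -{1}(prednK b0); apply: trace_iso_clebsch_gordan; last by rewrite e.
by apply: (cg_coef_neq0 chp _ e); lia.
Qed.

End Symmetric.

Local Close Scope ring_scope.

Theorem corollary1p3 (p n : nat) (k : fieldType) (gT : finGroupType)
    (G : {group gT}) (W : mx_representation k G 2) (i j r j' : nat)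
    (p_prime : prime p) (char_k : p \in [pchar k]%R)
    (n_gt0 : 0 < n) (abelG : (p.-abelem G)%g) (cardG : #|G| = p ^ n)
    (faithfulW : mx_faithful W) (indecW : mx_indecomposable W)
    (i_gt0 : 0 < i) (i_lt_p : i < p)
    (j_gt0 : 0 < j) (j_lt_q : j < p ^ n) (ij_le_q : i + j <= p ^ n)
    (j_eq : j = r * p + j') (j'_lt_p : j' < p) (ij'_ge_p : p <= i + j') :
  stable_iso
    (\big[@dadd_grepr k gT G/grepr0]_(1 <= s < (p ^ n.-1).+1) Vmod W (s * p))
    (tensor_grepr (Vmod W (p - i)) (Vmod W j))
    (tensor_grepr (Vmod W i) (Vmod W (p * r + p - j'))).
Proof.
set M := \big[_/_]_(_ <= _ < _) _.
have detW := det_abelem W char_k abelG.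
(* so that V_((r+1)p) is one of the summands of M *)
have r_lt : r < p ^ n.-1.
  rewrite -(ltn_pmul2r (prime_gt0 p_prime)) -expnSr prednK //.
  by apply: leq_ltn_trans j_lt_q; rewrite j_eq leq_addr.
have sum_M s : 0 < s <= p ^ n.-1 -> summand (Vmod W (s * p)) M.
  move=> hs; apply: (@summand_big k gT G _ _ (fun s => Vmod W (s * p))).
  by rewrite mem_index_iota ltnS.
have sum_r := sum_M r.+1 r_lt.
have sum_1 := sum_M 1 (leq_ltn_trans (leq0n r) r_lt).
have j'_bnd : 0 < j' < p by lia.
have pj'_bnd : 0 < p - j' < p by lia.
have i_bnd : 0 < i < p by lia.
have reflect_i := trace_iso_reflect detW char_k sum_1 isT i_bnd.
have reflect_pj' := trace_iso_reflect detW char_k sum_1 isT pj'_bnd.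
have reflect_r_j' := trace_iso_reflect detW char_k sum_r isT j'_bnd.
have reflect_r_pj' := trace_iso_reflect detW char_k sum_r isT pj'_bnd.
rewrite mul1n in reflect_i reflect_pj'.
rewrite subKn in reflect_pj'; last exact: ltnW.
have ej : r.+1 * p - (p - j') = j by rewrite j_eq mulSn; lia.
have er : r.+1 * p - j' = p * r + p - j' by rewrite mulSn mulnC addnC.
rewrite {}ej in reflect_r_pj'; rewrite {}er in reflect_r_j'.
apply: stable_iso_trace.
set A := Vmod W (p - 1) in reflect_i reflect_pj'.
set B := Vmod W (r.+1 * p - 1) in reflect_r_j' reflect_r_pj'.
set C := Vmod W (p - j') in reflect_pj' reflect_r_pj'.
have step1 : trace_iso M (tensor_grepr (Vmod W (p - i)) (Vmod W j))
    (tensor_grepr (tensor_grepr (Vmod W i) A) (tensor_grepr C B)).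
  apply: (trace_iso_trans
    (Y := tensor_grepr (tensor_grepr (Vmod W i) A) (Vmod W j))).
    apply/trace_iso_tensorl/trace_iso_sym.
    exact: trace_iso_trans (trace_iso_comm _ _ _) reflect_i.
  apply/trace_iso_tensorr/trace_iso_sym.
  exact: trace_iso_trans (trace_iso_comm _ _ _) reflect_r_pj'.
apply: trace_iso_trans step1 _.
apply: trace_iso_trans (trace_iso_sym (trace_iso_assoc _ _ _ _)) _.
apply: trace_iso_tensorr.
apply: trace_iso_trans (trace_iso_assoc _ _ _ _) _.
apply: trace_iso_trans (trace_iso_tensorl _ reflect_pj') _.
exact: trace_iso_trans (trace_iso_comm _ _ _) reflect_r_j'.
Qed.
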